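(* Let $G,H$ be finite simple connected graphs, fix a root $(r_G,r_H)\in V(G\,\square\,H)$, let $K\in\{G,H\}$ with $\bar K$ the other graph, and write $r_{\bar K}$ for the $\bar K$-coordinate of the root. Let $\alpha\in\{1,\dots,\mathrm{diam}(\bar K)\}$ and let $P$ be a path in $\bar K$ of edge length $\alpha$, $r_{\bar K}=p_0\sim p_1\sim\cdots\sim p_\alpha$. Put $M=2\pi(G)\pi(H)$. Then every configuration $c$ on $G\,\square\,H$ from which no sequence of pebbling moves places a pebble on $(r_G,r_H)$ satisfies \[ 1+\sum_{i=1}^{\alpha}2^{\alpha-i}\bigl(\tilde c_{K,p_i}-|K|\bigr)\ \le\ 2^{\alpha}\bigl(\pi(K)-\tilde c_{K,r_{\bar K}}\bigr)+2^{\alpha}M\Bigl(\alpha-\sum_{i=1}^{\alpha}x_{K,p_i,1}\Bigr). \]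
   Context: The Cartesian product $G\,\square\,H$ has vertex set $V(G)\times V(H)$, with $(g,h)\sim(g',h')$ iff ($g=g'$ and $h\sim_H h'$) or ($h=h'$ and $g\sim_G g'$). $|X|$ is the number of vertices of $X$ and $\mathrm{diam}$ its diameter. A configuration is a function $c:V(G\,\square\,H)\to\mathbb{Z}_{\ge0}$. A pebbling move removes two pebbles from a vertex and adds one to an adjacent vertex. $\pi(X)$ (pebbling number) is the least $k$ such that from every configuration of size $k$ on $X$ and every root some sequence of pebbling moves places a pebble on the root. For $K\in\{G,H\}$, $\bar K$ is the other graph; for $j\in V(\bar K)$ the $K$-slice $K_j$ is $\{(i,j):i\in V(G)\}$ if $K=G$ and $\{(j,h):h\in V(H)\}$ if $K=H$. For a configuration $c$: $\tilde c_{K,j}=\sum_{u\in K_j}c(u)$; $set_{K,j}=\lfloor\tilde c_{K,j}/\pi(K)\rfloor$; $extra_{K,j}=\tilde c_{K,j}-\pi(K)\,set_{K,j}$; $sat_{K,j}=\lfloor(\tilde c_{K,j}-extra_{K,j})/|K|\rfloor$; $x_{K,j,t}=1$ if $sat_{K,j}\ge t$ and $0$ otherwise. *)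

(* Defs.v *)
From mathcomp Require Import all_boot.
From mathcomp Require Import boolp.

Set Implicit Arguments.
Unset Strict Implicit.
Unset Printing Implicit Defensive.

(* The least n satisfying P; the value 0 is junk when no n satisfies P. *)
Definition least (P : nat -> Prop) : nat :=
  match pselect (exists n, `[< P n >]) with
  | left exP => ex_minn exP
  | right _ => 0
  end.

Lemma leastP (P : nat -> Prop) :
  (exists n, P n) -> P (least P) /\ (forall n, P n -> least P <= n).
Proof.
move=> [n Pn]; rewrite /least; case: pselect => [exP|[]]; last first.
  by exists n; apply/asboolP.
case: ex_minnP => m /asboolP Pm min_m; split=> // k Pk.
by apply: min_m; apply/asboolP.
Qed.

Record sgraph := SGraph {
  vertex :> finType;
  adj : rel vertex;
  adj_sym : symmetric adj;
  adj_irr : irreflexive adj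
}.
Arguments adj {s} x y.

Definition connected (G : sgraph) : Prop := forall x y : G, connect adj x y.

Definition dist (G : sgraph) (x y : G) : nat :=
  least (fun n => exists p : seq G,
    [/\ path adj x p, last x p = y & size p = n]).

Definition diam (G : sgraph) : nat := \max_(x : G) \max_(y : G) dist x y.

Section CartesianProduct.
Variables G H : sgraph.

Definition cart_adj : rel (G * H) := fun u v =>
  ((u.1 == v.1) && adj u.2 v.2) || ((u.2 == v.2) && adj u.1 v.1).

Lemma cart_adj_sym : symmetric cart_adj.
Proof.
move=> u v; rewrite /cart_adj [u.1 == _]eq_sym [u.2 == _]eq_sym.
by rewrite [adj u.1 _]adj_sym [adj u.2 _]adj_sym.
Qed.

Lemma cart_adj_irr : irreflexive cart_adj.
Proof. by move=> u; rewrite /cart_adj !adj_irr !andbF. Qed.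

Definition cart : sgraph := SGraph cart_adj_sym cart_adj_irr.

End CartesianProduct.

Notation "G □ H" := (cart G H) (at level 40, left associativity).

Definition config (G : sgraph) := {ffun G -> nat}.

Definition config_size (G : sgraph) (c : config G) : nat := \sum_(x : G) c x.

Definition pebbling_move (G : sgraph) (c c' : config G) : Prop :=
  exists u v : G, [/\ adj u v, 2 <= c u &
    c' = [ffun w => if w == u then c w - 2
                    else if w == v then c w + 1 else c w]].

Inductive reachable (G : sgraph) (c : config G) : config G -> Prop :=
| reachable_refl : reachable c c
| reachable_step c1 c2 :
    reachable c c1 -> pebbling_move c1 c2 -> reachable c c2.

Definition solvable (G : sgraph) (c : config G) (r : G) : Prop :=
  exists2 c', reachable c c' & 0 < c' r.

Definition pebbling_number (G : sgraph) : nat :=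
  least (fun k => forall (c : config G) (r : G),
    config_size c = k -> solvable c r).

Section PebblingNumberExists.
Variable G : sgraph.
Implicit Types c : config G.

Lemma reachable_trans c1 c2 c3 :
  reachable c1 c2 -> reachable c2 c3 -> reachable c1 c3.
Proof.
by move=> r12; elim=> [//|c4 c5 _ r14 m45]; apply: reachable_step r14 m45.
Qed.

Lemma push_edge (u v : G) m c : adj u v -> 2 * m <= c u ->
  exists2 c', reachable c c' & m <= c' v.
Proof.
move=> uv; have neq_vu : (v == u) = false.
  by apply: contraTF uv => /eqP->; rewrite adj_irr.
suff H k : k <= m -> 2 * m <= c u ->
    exists c', [/\ reachable c c', k <= c' v & 2 * (m - k) <= c' u].
  by move=> /(H m (leqnn m)) [c' [r' le' _]]; exists c'.
elim: k => [|k IHk] lt_km le_m.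
  by exists c; split; [left | | rewrite subn0].
have [c' [r' le_k le_u]] := IHk (ltnW lt_km) le_m.
have eq_mk : m - k = (m - k.+1).+1 by rewrite subnSK.
rewrite eq_mk mulnS in le_u.
exists [ffun w => if w == u then c' w - 2
                  else if w == v then c' w + 1 else c' w].
split; last 2 first.
- by rewrite ffunE neq_vu eqxx addn1.
- by rewrite ffunE eqxx leq_subRL // (leq_trans _ le_u) // leq_addr.
apply: reachable_step r' _; exists u, v; split=> //.
by rewrite (leq_trans _ le_u) // leq_addr.
Qed.

Lemma push_path (p : seq G) x m c : path adj x p -> 2 ^ size p * m <= c x ->
  exists2 c', reachable c c' & m <= c' (last x p).
Proof.
elim: p x c => [|y p IHp] x c /=; first by rewrite mul1n; exists c => //; left.
case/andP=> xy yp; rewrite expnS -mulnA => /(push_edge xy) [c1 r1 le1].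
have [c2 r2 le2] := IHp _ _ yp le1.
by exists c2 => //; apply: reachable_trans r1 r2.
Qed.

Lemma pebbling_number_ex : connected G ->
  exists k, forall c (r : G), config_size c = k -> solvable c r.
Proof.
move=> conG; exists (#|G| * 2 ^ #|G|) => c r szc.
have [x le_x] : exists x, 2 ^ #|G| <= c x.
  apply/existsP; apply: contraT => /existsPn small.
  have := ltnn (config_size c); rewrite {2}szc => <-.
  rewrite /config_size -sum_nat_const (bigD1 r) //= [ltnRHS](bigD1 r) //=.
  by rewrite -addSn leq_add ?ltnNge ?small // leq_sum // => i _;
    rewrite ltnW // ltnNge small.
have /connectP[p0 px0 ->] := conG x r; case/shortenP: px0 => p px up _.
have szp : size p <= #|G|.
  by rewrite -(card_uniqP (proj2 (andP up))) max_card.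
have [|c' rc' lt0] := @push_path p x 1 c px.
  by rewrite muln1 (leq_trans _ le_x) // leq_exp2l.
by exists c'.
Qed.

(* The junk value in [least] is not used for connected graphs. *)
Lemma pebbling_numberP : connected G ->
  (forall c (r : G), config_size c = pebbling_number G -> solvable c r) /\
  (forall k, (forall c (r : G), config_size c = k -> solvable c r) ->
    pebbling_number G <= k).
Proof. by move=> /pebbling_number_ex /leastP. Qed.

End PebblingNumberExists.

(* The choice of K among {G, H}: [KG] stands for K = G, [KH] for K = H. *)
Variant side := KG | KH.

Definition other (K : side) : side := if K is KG then KH else KG.

Section Slices.
Variables G H : sgraph.

Definition factor (K : side) : sgraph := if K is KG then G else H.

Definition coordinate (K : side) (u : G □ H) : factor K :=
  match K with KG => u.1 | KH => u.2 end.

Definition slice (K : side) : factor (other K) -> {set G □ H} :=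
  match K with
  | KG => fun j : H => [set (i, j) | i : G]
  | KH => fun j : G => [set (j, h) | h : H]
  end.

Variables (c : config (G □ H)) (K : side) (j : factor (other K)).

Definition slice_size : nat := \sum_(u in slice j) c u.

Definition nsets : nat := slice_size %/ pebbling_number (factor K).

Definition extra : nat := slice_size - pebbling_number (factor K) * nsets.

Definition sat : nat := (slice_size - extra) %/ #|factor K|.

Definition xsat (t : nat) : nat := if t <= sat then 1 else 0.

End Slices.

(* Main.v *)
(* From a slice carrying N pebbles one can move at least (N - |K|) / 2 pebbles
   to an adjacent slice, since at most one pebble per vertex is left behind.
   Doing this along P, from its far end to the root slice, accumulates at least
   c_0 + \sum_i (c_i - |K|) / 2^i pebbles in the root slice, and this must be
   less than pi(K). The term in M is nonnegative slack. *)
Require Import Defs.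
From mathcomp Require Import all_boot all_order all_algebra.
From mathcomp Require Import zify lra.

Set Implicit Arguments.
Unset Strict Implicit.
Unset Printing Implicit Defensive.

Import Order.TTheory GRing.Theory Num.Theory.
Local Open Scope ring_scope.

Definition add_pebble (G : sgraph) (c : config G) (u : G) : config G :=
  [ffun w => (c w + (w == u))%N].

Lemma pebbling_move_add (G : sgraph) (c c' : config G) (x : G) :
  pebbling_move c c' -> pebbling_move (add_pebble c x) (add_pebble c' x).
Proof.
move=> [u [v [uv le2 ->]]]; exists u, v; split=> //.
  by rewrite ffunE (leq_trans le2) ?leq_addr.
apply/ffunP=> w; rewrite !ffunE; case: eqP => [->|_]; first lia.
by case: eqP => _; lia.
Qed.

Lemma solvable_add (G : sgraph) (c : config G) (x r : G) :
  solvable c r -> solvable (add_pebble c x) r.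
Proof.
move=> [c' rc' c'r]; exists (add_pebble c' x); last by rewrite ffunE ltn_addr.
elim: rc' => [|c1 c2 _ r1 /(pebbling_move_add x)]; first by left.
exact: reachable_step.
Qed.

(** The pebbling number only speaks of configurations of exactly that size. A larger one is reduced
    to that size by removing surplus pebbles one at a time, and putting a pebble back keeps every
    move legal. *)
Lemma solvable_large (G : sgraph) (c : config G) (r : G) : connected G ->
  (pebbling_number G <= config_size c)%N -> solvable c r.
Proof.
move=> conG; have [piP _] := pebbling_numberP conG.
move=> /subnKC; move: (config_size c - _)%N => k.
elim: k c => [|k IHk] c; first by rewrite addn0 => /esym; apply: piP.
rewrite addnS => szc.
have [u cu] : exists u, (0 < c u)%N.
  apply/existsP; apply: contraT => /existsPn c0.
  by rewrite /config_size big1 // in szc => u _; have := c0 u; lia.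
pose d : config G := [ffun w => (c w - (w == u))%N].
have -> : c = add_pebble d u.
  by apply/ffunP => w; rewrite !ffunE; case: eqP => [->|_] /=; lia.
apply/solvable_add/IHk; apply: succn_inj; rewrite szc /config_size.
rewrite (bigD1 u) //= [in RHS](bigD1 u) //= ffunE eqxx.
under [in RHS]eq_bigr => w /negPf wu do rewrite ffunE wu subn0.
lia.
Qed.

(** Lets a pebbling game on [K] be played inside one copy of [K] in [X]. Injectivity of [f] ensures
    that a lifted move changes no other pulled-back vertex. *)
Lemma reachable_embed (K X : sgraph) (f : K -> X) (c : config X)
    (d : config K) :
    injective f -> (forall u v, adj u v -> adj (f u) (f v)) ->
    reachable [ffun i => c (f i)] d ->
  exists2 c', reachable c c' & forall i, c' (f i) = d i.
Proof.
move=> f_inj f_hom; elim=> [|d1 d2 _ [c1 rc1 fc1] [u [v [uv le2 ->]]]].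
  by exists c => [|i]; [left | rewrite ffunE].
exists [ffun w => if w == f u then (c1 w - 2)%N
                  else if w == f v then (c1 w + 1)%N else c1 w].
  by apply: reachable_step rc1 _; exists (f u), (f v); split; rewrite ?fc1 ?f_hom.
by move=> i; rewrite !ffunE !(inj_eq f_inj) fc1.
Qed.

(** An abstract view of the product as copies [e j] of [K] indexed by [L], so that both choices of
    the side are treated by one argument. *)
Section LayeredGraph.
Variables (K L X : sgraph) (e : L -> K -> X).
Hypothesis e_eq :
  forall j i j' i', (e j i == e j' i') = (j == j') && (i == i').
Hypothesis e_adjK : forall j i i', adj i i' -> adj (e j i) (e j i').
Hypothesis e_adjL : forall j j' i, adj j j' -> adj (e j i) (e j' i).
Implicit Types (c : config X) (j x y : L).

Definition layer_size c j : nat := (\sum_(i : K) c (e j i))%N.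

Lemma solvable_layer c j (i : K) : connected K ->
  (pebbling_number K <= layer_size c j)%N -> solvable c (e j i).
Proof.
move=> conK le_c.
have [|d rd di] := @solvable_large K [ffun i => c (e j i)] i conK.
  by rewrite /config_size; under eq_bigr do rewrite ffunE.
have [||c' rc' c'd] := reachable_embed _ _ rd.
- by move=> u v /eqP; rewrite e_eq eqxx => /eqP.
- by move=> u v; apply: e_adjK.
by exists c' => //; rewrite c'd.
Qed.

(** While layer [y] holds more than [#|K|] pebbles, pigeonhole gives a vertex with two of them, and
    a move to its copy in layer [x] is possible. The subtraction is truncated, so the growth of
    layer [x] is recorded separately. *)
Lemma drain_layer c x y : adj y x ->
  exists c', [/\ reachable c c',
    (layer_size c y <= (layer_size c' x - layer_size c x) * 2 + #|K|)%N,
    (layer_size c x <= layer_size c' x)%N &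
    forall j, j != x -> j != y -> layer_size c' j = layer_size c j].
Proof.
move=> yx; have neq_xy : (x == y) = false.
  by apply: contraTF yx => /eqP->; rewrite adj_irr.
have [n] := ubnP (layer_size c y); elim: n c => // n IHn c lt_n.
have [le_K|lt_K] := leqP (layer_size c y) #|K|.
  by exists c; split=> //; [left | rewrite subnn].
have [i le2] : exists i, (2 <= c (e y i))%N.
  apply/existsP; apply: contraTT lt_K => /existsPn small.
  rewrite -leqNgt -sum1_card leq_sum // => i _.
  by have := small i; lia.
pose c1 : config X := [ffun w => if w == e y i then (c w - 2)%N
                       else if w == e x i then (c w + 1)%N else c w].
have c1y : layer_size c y = (layer_size c1 y + 2)%N.
  rewrite /layer_size (bigD1 i) //= [in RHS](bigD1 i) //= ffunE eqxx.
  under [in RHS]eq_bigr => k /negPf ki.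
    rewrite ffunE !e_eq ki !andbF; over.
  lia.
have c1x : layer_size c1 x = (layer_size c x + 1)%N.
  rewrite /layer_size (bigD1 i) //= [in RHS](bigD1 i) //= ffunE !e_eq neq_xy !eqxx.
  under eq_bigr => k /negPf ki.
    rewrite ffunE !e_eq ki !andbF; over.
  rewrite /=; lia.
have c1j j : j != x -> j != y -> layer_size c1 j = layer_size c j.
  move=> /negPf jx /negPf jy; apply: eq_bigr => k _.
  by rewrite ffunE !e_eq jx jy.
have [|c' [r' le_y le_x eq_j]] := IHn c1; first lia.
exists c'; split; [|lia|lia|by move=> j jx jy; rewrite eq_j ?c1j].
apply: reachable_trans r'; apply: reachable_step (reachable_refl _) _.
by exists (e y i), (e x i); split=> //; apply: e_adjL.
Qed.

(** The tail is drained into its first layer [y], then [y] into [x]. The last clause carries the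
    induction: since [x] is not on the tail, its layer is still intact when [y] is drained. Scaling
    by [2 ^+ size p] keeps the weights integral. *)
Lemma drain_path c x (p : seq L) j0 : path adj x p -> uniq (x :: p) ->
  exists c', [/\ reachable c c',
    2 ^+ size p * (layer_size c x)%:Z +
      \sum_(i < size p) 2 ^+ (size p - i.+1) *
        ((layer_size c (nth j0 p i))%:Z - #|K|%:Z)
      <= 2 ^+ size p * (layer_size c' x)%:Z &
    forall j, j \notin x :: p -> layer_size c' j = layer_size c j].
Proof.
elim: p x => [|y p IHp] x /=.
  by exists c; split=> //; [left | rewrite big_ord0 addr0].
case/andP=> xy yp /andP[x_notin uniq_yp].
have [c1 [r1 le1 eq1]] := IHp y yp uniq_yp.
have [|c2 [r2 le_y le_x eq2]] := @drain_layer c1 x y; first by rewrite adj_sym.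
exists c2; split; first exact: reachable_trans r1 r2.
  (* The first summand belongs to [y]; after the index shift the others form exactly the sum of the
     induction hypothesis. *)
  rewrite big_ord_recl /= subn1 /=.
  under eq_bigr => i _ do rewrite /bump /= add1n subSS.
  rewrite -(eq1 x x_notin) exprS.
  move: le1; set S := \sum_(_ < _) _.
  have : (layer_size c1 y)%:Z <=
      ((layer_size c2 x)%:Z - (layer_size c1 x)%:Z) * 2 + #|K|%:Z by lia.
  have : 0 <= 2 ^+ size p :> int by rewrite exprn_ge0.
  move: (2 ^+ size p) => a a_ge0 /(ler_wpM2l a_ge0).
  by move=> h1 h2; lra.
move=> j; rewrite inE negb_or => /andP[jx j_yp].
by rewrite eq2 ?eq1 //; move: j_yp; rewrite inE negb_or => /andP[].
Qed.

Lemma unsolvable_path_bound c j0 (i0 : K) (p : seq L) : connected K ->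
    path adj j0 p -> uniq (j0 :: p) -> ~ solvable c (e j0 i0) ->
  1 + \sum_(1 <= i < (size p).+1) 2 ^+ (size p - i) *
        ((layer_size c (nth j0 (j0 :: p) i))%:Z - #|K|%:Z)
    <= 2 ^+ size p * ((pebbling_number K)%:Z - (layer_size c j0)%:Z).
Proof.
move=> conK path_p uniq_p unsolv.
have [c' [rc' le_c' _]] := drain_path c j0 path_p uniq_p.
have lt_pi : (layer_size c' j0 < pebbling_number K)%N.
  rewrite ltnNge; apply/negP => /(solvable_layer i0 conK) [d rd d_gt0].
  by apply: unsolv; exists d => //; apply: reachable_trans rc' rd.
rewrite big_add1 /= big_mkord.
move: le_c'; set S := \sum_(_ < _) _.
(* Scaled by [2 ^+ size p], this strict bound leaves a surplus of at least 1, which is the leading 1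
   of the claim. *)
have : (layer_size c' j0)%:Z + 1 <= (pebbling_number K)%:Z by lia.
have : 1 <= 2 ^+ size p :> int by rewrite exprn_ege1.
move: (2 ^+ size p) => a a_ge1.
have a_ge0 : 0 <= a by apply: le_trans a_ge1.
by move=> /(ler_wpM2l a_ge0) h1 h2; lra.
Qed.

End LayeredGraph.

Definition slice_embed (G H : sgraph) (K : side) :
    factor G H (other K) -> factor G H K -> G □ H :=
  match K with
  | KG => fun j i => (i, j)
  | KH => fun j i => (j, i)
  end.

Lemma slice_sizeE (G H : sgraph) (c : config (G □ H)) (K : side) j :
  slice_size c j = layer_size (@slice_embed G H K) c j.
Proof.
by case: K j => j; rewrite /slice_size /slice big_imset //= => i i' _ _ [].
Qed.

Lemma slice_embed_coordinate (G H : sgraph) (K : side) (u : G □ H) :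
  slice_embed (coordinate (other K) u) (coordinate K u) = u.
Proof. by case: K u => [] []. Qed.

(* P is the vertex sequence p_0 :: p, with p_0 the K-bar coordinate of the
   root and p_i the i-th entry of p_0 :: p. *)
Theorem theorem9 (G H : sgraph) (conG : connected G) (conH : connected H)
    (r : G □ H) (K : side) (alpha : nat)
    (alpha_gt0 : (1 <= alpha)%N)
    (alpha_le : (alpha <= diam (factor G H (other K)))%N)
    (p : seq (factor G H (other K)))
    (size_p : size p = alpha)
    (path_p : path adj (coordinate (other K) r) p)
    (uniq_p : uniq (coordinate (other K) r :: p))
    (c : config (G □ H)) (unsolv : ~ solvable c r) :
  let rK := coordinate (other K) r in
  let P := fun i : nat => nth rK (rK :: p) i in
  let piK := pebbling_number (factor G H K) in
  let M := (2 * pebbling_number G * pebbling_number H)%N in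
  1 + \sum_(1 <= i < alpha.+1)
        2 ^+ (alpha - i)%N * ((slice_size c (P i))%:Z - #|factor G H K|%:Z)
  <= 2 ^+ alpha * (piK%:Z - (slice_size c rK)%:Z)
     + 2 ^+ alpha * M%:Z
       * (alpha%:Z - \sum_(1 <= i < alpha.+1) (xsat c (P i) 1)%:Z).

Proof.
cbv zeta; set rK := coordinate (other K) r.
have bound : 1 + \sum_(1 <= i < alpha.+1)
    2 ^+ (alpha - i)%N *
    ((slice_size c (nth rK (rK :: p) i))%:Z - #|factor G H K|%:Z)
  <= 2 ^+ alpha * ((pebbling_number (factor G H K))%:Z - (slice_size c rK)%:Z).
  rewrite slice_sizeE; under eq_bigr do rewrite slice_sizeE.
  rewrite -size_p; apply: (@unsolvable_path_bound _ _ _ _ _ _ _ c rK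
    (coordinate K r) p) => //.
  - case: (K) => j i j' i' //=; exact: andbC.
  - by case: (K) => j i i' /= ii'; rewrite /cart_adj /= eqxx ii' ?orbT.
  - by case: (K) => j j' i /= jj'; rewrite /cart_adj /= eqxx jj' ?orbT.
  - by case: (K).
  - by rewrite slice_embed_coordinate.
apply: (le_trans bound); rewrite lerDl mulr_ge0 ?mulr_ge0 ?exprn_ge0 //.
(* Each indicator is at most 1, so the [alpha] of them sum to at most [alpha]. *)
rewrite subr_ge0 (le_trans (ler_sum _ (G := fun=> 1) _)) //.
  by move=> i _; rewrite /xsat; case: ifP.
by rewrite sumr_const_nat subn1 natz.
Qed.
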